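(* Let $m\geqslant2$ and $n>m$. Let $\xi\in(0,1)$ be irrational and let $p_\nu/q_\nu$, $\nu=1,2,\dots$, be all its continued fraction convergents. Consider the $n\times m$ matrix $\Theta=(\theta^i_j)$ whose second column is given by $\theta^2_j=-\xi\theta^1_j$ ($1\leqslant j\leqslant n$). Then for almost all (in the sense of Lebesgue measure) choices of the remaining $n(m-1)$ entries $\theta^i_j$, $i\in\{1,3,4,\dots,m\}$, $1\leqslant j\leqslant n$, subject to $1/3<\theta^1_1,\dots,\theta^1_{n-1}<2/3<\theta^1_n<1$ and $\theta^i_j\in(0,1)$ for $3\leqslant i\leqslant m$, the sequence of (extended) best approximation vectors of $\Theta$ differs from the sequence $(p_\nu,q_\nu,0,\dots,0)\in\mathbb Z^{m+n}$, $\nu=1,2,\dots$, by at most finitely many terms; consequently $R(\Theta)=2$.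
   Context: For a real $n\times m$ matrix $\Theta=(\theta^i_j)$: $L_j(\mathbf x)=\sum_i\theta^i_jx_i$ for $\mathbf x\in\mathbb Z^m$; $\|\cdot\|$ = distance to nearest integer; $M(\mathbf x)=\max_i|x_i|$; $\zeta(\mathbf x)=\max_j\|L_j(\mathbf x)\|$. A nonzero $\mathbf x\in\mathbb Z^m$ is a best approximation if $\zeta(\mathbf x)\leqslant\zeta(\mathbf x')$ for every nonzero $\mathbf x'$ with $M(\mathbf x')\leqslant M(\mathbf x)$; the extended vector of a best approximation is $(\mathbf x,y_1,\dots,y_n)\in\mathbb Z^{m+n}$ with $y_j\in\mathbb Z$, $|L_j(\mathbf x)+y_j|=\|L_j(\mathbf x)\|$; best approximations are ordered by increasing $M(\mathbf x)$ (each up to sign), giving extended vectors $\mathbf z_\nu$. $R(\Theta)$ is the least $r$ such that some lattice $\Lambda\subseteq\mathbb Z^{m+n}$ with $\dim\operatorname{span}\Lambda=r$ contains $\mathbf z_\nu$ for all sufficiently large $\nu$. *)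

(* Defs.v *)
(* MathComp / MathComp-Analysis. *)
From HB Require Import structures.
From mathcomp Require Import all_boot all_order all_algebra.
From mathcomp Require Import all_classical all_reals all_analysis.
Set Implicit Arguments.
Unset Strict Implicit.
Unset Printing Implicit Defensive.
Import Order.TTheory GRing.Theory Num.Theory.
Import numFieldNormedType.Exports.

Local Open Scope classical_set_scope.
Local Open Scope ring_scope.

(* Conventions: the n x m matrix Theta is indexed by Theta j i = theta^i_j
   (j : 'I_n a row, i : 'I_m a column, both numbered from 0), and integer
   vectors are row vectors. *)

Section BestApproximations.
Context {R : realType} {m n : nat}.
Implicit Types (Theta : 'M[R]_(n, m)) (x : 'rV[int]_m).

Definition dist_int (t : R) : R := inf [set `|t - k%:~R| | k in [set: int]].

Definition linform Theta (j : 'I_n) x : R :=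
  \sum_(i < m) Theta j i * (x ord0 i)%:~R.

Definition maxnorm x : nat := \max_(i < m) `|x ord0 i|%N.

(* The default value 0 of the maximum is harmless: the terms are >= 0. *)
Definition zeta Theta x : R :=
  \big[Num.max/0]_(j < n) dist_int (linform Theta j x).

Definition best_approx Theta x : Prop :=
  x != 0 /\
  forall x' : 'rV[int]_m, x' != 0 -> (maxnorm x' <= maxnorm x)%N ->
    zeta Theta x <= zeta Theta x'.

Definition ext_best_approx Theta (z : 'rV[int]_(m + n)) : Prop :=
  best_approx Theta (lsubmx z) /\
  forall j : 'I_n,
    `|linform Theta j (lsubmx z) + (rsubmx z ord0 j)%:~R|
      = dist_int (linform Theta j (lsubmx z)).

(* z enumerates the extended best approximations by increasing M(x), with
   exactly one representative of each pair {v, -v}.  The order is only required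
   to be nondecreasing because, for special Theta, several pairs may share the
   same value of M(x); thus every Theta has such an enumeration. *)
Definition best_approx_seq Theta (z : nat -> 'rV[int]_(m + n)) : Prop :=
  [/\ forall nu, ext_best_approx Theta (z nu),
      forall v, ext_best_approx Theta v -> exists nu, v = z nu \/ v = - z nu,
      forall mu nu, (mu < nu)%N -> z mu <> z nu /\ z mu <> - z nu
    & forall nu, (maxnorm (lsubmx (z nu)) <= maxnorm (lsubmx (z nu.+1)))%N].

End BestApproximations.

(* Two sequences of vectors, each vector being taken up to sign, coincide after
   deleting finitely many initial terms from each of them. *)
Definition differ_finitely {d : nat} (z w : nat -> 'rV[int]_d) : Prop :=
  exists N K : nat, forall nu,
    z (N + nu)%N = w (K + nu)%N \/ z (N + nu)%N = - w (K + nu)%N.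

Section Rank.
Context (R : realType).

(* A lattice contained in Z^d is the same thing as a subgroup of Z^d. *)
Definition sublattice {d : nat} (L : set 'rV[int]_d) : Prop :=
  L 0 /\ forall u v, L u -> L v -> L (u - v).

(* U is the real linear span of L in R^d. *)
Definition span_dim_is {d : nat} (L : set 'rV[int]_d) (r : nat) : Prop :=
  exists U : {vspace 'rV[R]_d},
    [/\ forall v, L v -> map_mx intr v \in U,
        forall W : {vspace 'rV[R]_d},
          (forall v, L v -> map_mx intr v \in W) -> (U <= W)%VS
      & \dim U = r].

Definition tail_rank {m n : nat} (Theta : 'M[R]_(n, m)) (r : nat) : Prop :=
  exists2 z, best_approx_seq Theta z &
  exists L : set 'rV[int]_(m + n),
    [/\ sublattice L, span_dim_is L r
      & exists N, forall nu, (N <= nu)%N -> L (z nu)].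

(* R(Theta) = r *)
Definition rank_is {m n : nat} (Theta : 'M[R]_(n, m)) (r : nat) : Prop :=
  tail_rank Theta r /\ forall r', tail_rank Theta r' -> (r <= r')%N.

End Rank.

Section ContinuedFractions.
Context {R : realType}.

Fixpoint cf_tail (xi : R) (k : nat) : R :=
  if k is k'.+1 then (cf_tail xi k' - (Num.floor (cf_tail xi k'))%:~R)^-1
  else xi.

Definition cf_quotient (xi : R) (k : nat) : int := Num.floor (cf_tail xi k).

(* ((p_k, q_k), (p_(k-1), q_(k-1))), with (p_(-1), q_(-1)) = (1, 0) *)
Fixpoint cf_pair (xi : R) (k : nat) : (int * int) * (int * int) :=
  if k is k'.+1 then
    let: ((p, q), (p', q')) := cf_pair xi k' in
    ((cf_quotient xi k * p + p', cf_quotient xi k * q + q'), (p, q))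
  else ((cf_quotient xi 0%N, 1), (1, 0)).

Definition cf_num (xi : R) (k : nat) : int := (cf_pair xi k).1.1.
Definition cf_den (xi : R) (k : nat) : int := (cf_pair xi k).1.2.

Definition convergent_vec (m n : nat) (xi : R) (k : nat) : 'rV[int]_(m + n) :=
  row_mx (\row_(i < m) if val i == 0%N then cf_num xi k
                       else if val i == 1%N then cf_den xi k else 0)
         0.

End ContinuedFractions.

Section Lebesgue.
Context {R : realType} {n k : nat}.
Implicit Types (a b : 'M[R]_(n, k)).

Definition mx_box a b : set 'M[R]_(n, k) :=
  [set T | forall j i, a j i <= T j i <= b j i].

(* Num.max makes the volume of an empty box equal to 0. *)
Definition mx_box_volume a b : R :=
  \prod_(j < n) \prod_(i < k) Num.max 0 (b j i - a j i).

(* Lebesgue outer measure on R^(n * k), the space of n x k matrices. *)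
Definition lebesgue_outer (A : set 'M[R]_(n, k)) : \bar R :=
  ereal_inf [set (\sum_(0 <= l <oo) (mx_box_volume (c l).1 (c l).2)%:E)%E
            | c in [set c : nat -> 'M[R]_(n, k) * 'M[R]_(n, k)
                   | A `<=` \bigcup_l mx_box (c l).1 (c l).2]].

Definition almost_all_in (D P : set 'M[R]_(n, k)) : Prop :=
  lebesgue_outer (D `\` P) = 0%E.

End Lebesgue.

Section Family.
Context {R : realType} {m n : nat}.

(* The free entries form an n x (m+1) matrix T: column 0 of T is theta^1 and
   columns 1, ..., m are theta^3, ..., theta^(m+2).  The column of index 1 of
   the resulting n x (m+2) matrix is -xi theta^1. *)
Definition dependent_mx (xi : R) (T : 'M[R]_(n, m.+1)) : 'M[R]_(n, m.+2) :=
  \matrix_(j, i) if unlift (1 : 'I_m.+2) i is Some i' then T j i'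
                 else - xi * T j ord0.

Definition admissible : set 'M[R]_(n, m.+1) :=
  [set T | (forall j : 'I_n,
              if j.+1 == n then 2 / 3 < T j ord0 < 1
              else 1 / 3 < T j ord0 < 2 / 3) /\
           (forall (j : 'I_n) (i : 'I_m.+1), i != ord0 -> 0 < T j i < 1)].

End Family.

(* Main.v *)
Require Import Defs.
From HB Require Import structures.
From mathcomp Require Import all_boot all_order all_algebra.
From mathcomp Require Import all_classical all_reals all_analysis.
From mathcomp Require Import zify ring lra.
Import Order.TTheory GRing.Theory Num.Theory.
Import numFieldNormedType.Exports.
Local Open Scope classical_set_scope.
Local Open Scope ring_scope.

(* For x = (p, q, 0, ..., 0) all the forms are multiples of w = p - xi q, and
   once |w| < 1/2 one has zeta(x) = theta^1_n |w|, so that among such x the best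
   approximations are given by the best approximation law for continued
   fractions.  For every other x some coefficient of the free entries in the
   forms L_j has absolute value at least 1/2, so that zeta(x) <= delta cuts out
   a set of parameters of measure O(delta^n), uniformly in x.  There are
   O(2^(k m)) vectors with M(x) <= 2^(k+1), and n > m, so Borel-Cantelli with
   delta = 2^-k gives, for almost all parameters, zeta(x) > 1/Q for all such x
   with M(x) <= Q and Q large; but the convergent with q_nu <= Q < q_(nu+1) has
   zeta < 1/q_(nu+1) < 1/Q. *)

Set Implicit Arguments.
Unset Strict Implicit.
Unset Printing Implicit Defensive.

(** * Coverings by boxes *)

Section Coverings.
Context {R : realType} {n k : nat}.
Implicit Types (A B : set 'M[R]_(n, k)) (s : seq ('M[R]_(n, k) * 'M[R]_(n, k))).

(** Finite lists keep unions over finitely many vectors and products over rows elementary; countable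
    families of boxes enter only in [lebesgue_outer_limsup]. *)
Definition coverable A (v : R) : Prop :=
  exists2 s, forall T, A T -> exists2 b, b \in s & mx_box b.1 b.2 T
           & \sum_(b <- s) mx_box_volume b.1 b.2 <= v.

Lemma mx_box_volume_ge0 (a b : 'M[R]_(n, k)) : 0 <= mx_box_volume a b.
Proof.
by rewrite /mx_box_volume; do 2! apply: prodr_ge0 => ? _; rewrite le_max lexx.
Qed.

Lemma coverable_sub A B (v w : R) :
  A `<=` B -> v <= w -> coverable B v -> coverable A w.
Proof.
move=> AB vw [s sB sv]; exists s; last exact: le_trans vw.
by move=> T /AB /sB.
Qed.

Lemma coverable_bigcup (I : eqType) (r : seq I) (A : I -> set 'M[R]_(n, k))
    (v : R) :
  0 <= v -> (forall i, i \in r -> coverable (A i) v) ->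
  coverable (\bigcup_(i in [set` r]) A i) ((size r)%:R * v).
Proof.
move=> v0; elim: r => [|i r IHr] Av.
  by exists [::] => [T [i]|] //; rewrite big_nil mul0r.
have [|s1 s1A s1v] := IHr; first by move=> j jr; apply: Av; rewrite inE jr orbT.
have [|s2 s2A s2v] := Av i; first by rewrite inE eqxx.
exists (s2 ++ s1) => [T [j /=]|].
  rewrite inE => /orP[/eqP ->|jr] AT.
    by have [b bs bT] := s2A T AT; exists b => //; rewrite mem_cat bs.
  have [|b bs bT] := s1A T; first by exists j.
  by exists b => //; rewrite mem_cat bs orbT.
by rewrite big_cat /= -natr1 mulrDl mul1r addrC lerD.
Qed.

Lemma lebesgue_outer_ge0 A : (0 <= lebesgue_outer A)%E.
Proof.
apply: le_ereal_inf_tmp => _ [c _ <-].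
by apply: nneseries_ge0 => i _ _; rewrite lee_fin mx_box_volume_ge0.
Qed.

Lemma almost_all_in_sub (D P Q : set 'M[R]_(n, k)) :
  (forall T, D T -> P T -> Q T) -> almost_all_in D P -> almost_all_in D Q.
Proof.
move=> PQ DP; apply/eqP; rewrite eq_le lebesgue_outer_ge0 andbT -DP.
apply: ereal_inf_le_tmp => _ [c Dc <-]; exists c => //.
by apply: subset_trans Dc => T [DT QT]; split=> // PT; apply: QT; exact: PQ.
Qed.

(** Borel-Cantelli: for every [N] the covers of the [A l] with [l >= N] jointly cover [B], and their
    total volume is at most [2 * C / 2 ^+ N]. *)
Lemma lebesgue_outer_limsup (A : nat -> set 'M[R]_(n, k)) (C : R)
    (B : set 'M[R]_(n, k)) :
  (0 < n)%N -> (0 < k)%N ->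
  (forall l, coverable (A l) (C / 2 ^+ l)) ->
  (forall N T, B T -> exists2 l, (N <= l)%N & A l T) ->
  lebesgue_outer B = 0%E.
Proof.
move=> n0 k0 covA BA; apply/eqP; rewrite eq_le; apply/andP; split; last first.
  exact: lebesgue_outer_ge0.
have C0 : 0 <= C.
  have [s _] := covA 0%N; rewrite expr0 divr1; apply: le_trans.
  by apply: sumr_ge0 => b _; exact: mx_box_volume_ge0.
apply/lee_addgt0Pr => e e0; rewrite add0e.
have [N Ne] : exists N, C / 2 ^+ N * 2 <= e.
  (* This [N] exceeds [2 * C / e], and [N < 2 ^ N]. *)
  exists (Num.truncn (e^-1 * (C * 2))).+1.
  rewrite mulrAC ler_pdivrMr ?exprn_gt0// mulrC -ler_pdivrMl// mulrC.
  apply/(le_trans (ltW (truncnS_gt _))).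
  by rewrite -natrX ler_nat; apply/ltnW/ltn_expl.
pose P l (s : seq ('M[R]_(n, k) * 'M[R]_(n, k))) :=
  (forall T, A (N + l)%N T -> exists2 b, b \in s & mx_box b.1 b.2 T) /\
  \sum_(b <- s) mx_box_volume b.1 b.2 <= C / 2 ^+ (N + l).
have [S PS] : {S : nat -> seq ('M[R]_(n, k) * 'M[R]_(n, k)) & forall l, P l (S l)}.
  by apply: (@choice _ _ P) => l; have [s sA sv] := covA (N + l)%N; exists s.
(* Each list is padded to an infinite sequence by the one-point box [(0, 0)], whose volume is 0
   because [n] and [k] are positive. *)
pose G (p : nat * nat) := nth (0, 0) (S p.1) p.2.
pose vol (b : 'M[R]_(n, k) * 'M[R]_(n, k)) := (mx_box_volume b.1 b.2)%:E : \bar R.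
have vol_ge0 b : (0 <= vol b)%E by rewrite lee_fin mx_box_volume_ge0.
have vol00 : vol (0, 0) = 0%E.
  rewrite /vol /mx_box_volume (bigD1 (Ordinal n0)) //= (bigD1 (Ordinal k0)) //=.
  by rewrite !mxE subrr maxxx !mul0r.
have volS l : (\sum_(0 <= i <oo) vol (G (l, i)) <= (C / 2 ^+ (N + l))%:E)%E.
  rewrite (nneseries_split 0 (size (S l))); last by move=> *; exact: vol_ge0.
  rewrite add0n [X in (_ + X)%E]eseries0 ?adde0.
    rewrite [leLHS](_ : _ = (\sum_(b <- S l) vol b)%E); last first.
      by rewrite (big_nth (0, 0)) !big_mkord.
    rewrite /vol sumEFin lee_fin; exact: (PS l).2.
  by move=> i /= si _; rewrite /G /= nth_default.
(* A bijection from [nat] to pairs flattens the double family; volumes are nonnegative, so the sum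
   may be taken list by list. *)
have /card_esym/ppcard_eqP[f] := card_nat2.
apply: (@le_trans _ _ (\esum_(p in [set: nat * nat]) vol (G p))%E).
  apply: ereal_inf_lbound; exists (G \o f) => /=.
    move=> T BT; have [l Nl AT] := BA N T BT.
    have [|b bS bT] := (PS (l - N)%N).1 T; first by rewrite subnKC.
    exists (f^-1%FUN ((l - N)%N, index b (S (l - N)%N))) => //=.
    by rewrite invK ?inE // /G /= nth_index.
  rewrite -(esum_pred_image (vol \o G) f xpredT) ?[fun=> _]set_true//.
  - by rewrite image_eq.
  - by move=> i _; exact: vol_ge0.
have -> : [set: nat * nat] = [set: nat] `*`` (fun=> [set: nat]).
  by apply/seteqP; split.
rewrite -(@esum_esum R _ _ _ _ (fun i j => vol (G (i, j)))) //.
apply: (@le_trans _ _ (\esum_(i in [set: nat]) (C / 2 ^+ (N + i))%:E)%E).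
  by apply: le_esum => i _; rewrite -nneseries_esumT.
rewrite -nneseries_esumT; last by move=> i; rewrite lee_fin divr_ge0 ?exprn_ge0.
rewrite (eq_eseriesr (g := fun i => ((C / 2 ^+ N * 2) / (2 ^ (i + 1))%:R)%:E)).
  rewrite (cvg_lim _ (@cvg_geometric_eseries_half R (C / 2 ^+ N * 2) 0)) //.
  by rewrite expr0 divr1 lee_fin.
move=> i _; congr (_ %:E); rewrite natrX addn1 exprSr exprD; field.
by rewrite !expf_neq0.
Qed.
End Coverings.

(** * Parameters with a small linear form *)

Section DistInt.
Context {R : realType}.
Implicit Types (t : R) (y : int).

(** Any other integer is at distance at least 1 from [y], hence at least 1/2 from [t]. *)
Lemma dist_intE t y : `|t - y%:~R| <= 1 / 2 -> dist_int t = `|t - y%:~R|.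
Proof.
move=> ty; apply/eqP; rewrite eq_le; apply/andP; split.
  apply: ge_inf; last by exists y.
  by exists 0 => _ [z _ <-].
apply: lb_le_inf; first by exists `|t - 0%:~R|, 0.
move=> _ [z _ <-]; have [->//|zy] := eqVneq z y.
have : 1 <= `|(z - y)%:~R : R|.
  by rewrite -intr_norm -[1]/(1%:~R) ler_int -gtz0_ge1 normr_gt0 subr_eq0.
have : `|(z - y)%:~R : R| <= `|t - y%:~R| + `|t - z%:~R|.
  have -> : (z - y)%:~R = (t - y%:~R) - (t - z%:~R) :> R by ring.
  exact: ler_normB.
lra.
Qed.

Lemma dist_int_nearest t : exists2 y, `|t - y%:~R| <= 1 / 2 &
  dist_int t = `|t - y%:~R|.
Proof.
suff h : `|t - (Num.floor (t + 1 / 2))%:~R| <= 1 / 2 :> R.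
  by exists (Num.floor (t + 1 / 2)) => //; exact: dist_intE.
have /andP[] := floor_itv (t + 1 / 2); rewrite intrD ler_norml; lra.
Qed.

Lemma dist_int_id t : `|t| <= 1 / 2 -> dist_int t = `|t|.
Proof. by move=> t2; rewrite (@dist_intE t 0) subr0. Qed.

Lemma dist_int_le_norm t : dist_int t <= `|t|.
Proof.
have [/dist_int_id -> //|t2] := leP `|t| (1 / 2).
by have [y ty ->] := dist_int_nearest t; exact/(le_trans ty)/ltW.
Qed.

End DistInt.

(** * Covering the points of the unit cube where a linear form is nearly an integer *)

Section Slabs.
Context {R : realType}.

(** Choose a box of the cover independently for each row; by distributivity the volumes of the
    products add up to the [n]-th power of the original sum. This is the source of the exponent [n]
    in the measure estimate. *)
Lemma coverable_rows n k (B : set 'M[R]_(1, k)) (v : R) :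
  coverable B v ->
  coverable [set T : 'M[R]_(n, k) | forall j, B (row j T)] (v ^+ n).
Proof.
case=> s sB sv.
pose box (f : {ffun 'I_n -> 'I_(size s)}) : 'M[R]_(n, k) * 'M[R]_(n, k) :=
  (\matrix_(j, i) (nth (0, 0) s (f j)).1 ord0 i,
   \matrix_(j, i) (nth (0, 0) s (f j)).2 ord0 i).
exists (codom box) => [T BT|].
  have [f fP] : {f : 'I_n -> 'I_(size s) & forall j,
      mx_box (nth (0, 0) s (f j)).1 (nth (0, 0) s (f j)).2 (row j T)}.
    apply: (@choice _ _ (fun j (i : 'I_(size s)) =>
      mx_box (nth (0, 0) s i).1 (nth (0, 0) s i).2 (row j T))) => j.
    have [b bs bT] := sB _ (BT j).
    have bi : (index b s < size s)%N by rewrite index_mem.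
    by exists (Ordinal bi); rewrite /= nth_index.
  exists (box (finfun f)); first exact: codom_f.
  by move=> j i; have := fP j ord0 i; rewrite !mxE ffunE.
have v0 : 0 <= \sum_(b <- s) mx_box_volume b.1 b.2.
  by apply: sumr_ge0 => *; exact: mx_box_volume_ge0.
apply: le_trans (lerXn2r n v0 (le_trans v0 sv) sv).
rewrite big_map big_enum /= -[n in _ ^+ n]card_ord -prodr_const.
rewrite (big_nth (0, 0)) big_mkord bigA_distr_bigA /= le_eqVlt; apply/orP; left.
apply/eqP/eq_bigr => f _; apply: eq_bigr => j _.
by rewrite /mx_box_volume big_ord1; apply: eq_bigr => i _; rewrite !mxE.
Qed.

Lemma grid_cell (N : nat) (t : R) : 0 < t < 1 ->
  exists g : 'I_N.+1, g%:R / N.+1%:R <= t <= g.+1%:R / N.+1%:R.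
Proof.
move=> /andP[t0 t1].
have tN0 : 0 <= t * N.+1%:R by rewrite mulr_ge0 // ltW.
have /andP[lo hi] := truncn_itv tN0.
have gN : (Num.truncn (t * N.+1%:R) < N.+1)%N.
  by rewrite -(ltr_nat R) (le_lt_trans lo) // gtr_pMl.
exists (Ordinal gN) => /=.
by rewrite ler_pdivrMr // lo ler_pdivlMr // ltW.
Qed.

(* Grid all coordinates but p so finely that the form varies by at most d on a
   cell; then t_p lies in one of O(|c p|) intervals of length 4 d / |c p|. *)
Lemma coverable_slab m (c : 'I_m.+1 -> R) (p : 'I_m.+1) (d : R) :
  1 / 2 <= `|c p| -> 0 < d <= 1 ->
  coverable [set t : 'M[R]_(1, m.+1) | (forall i, 0 < t ord0 i < 1) /\
               dist_int (\sum_i t ord0 i * c i) <= d] (80 * d).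
Proof.
move=> cp /andP[d0 d1].
have cp0 : 0 < `|c p| by lra.
have cpn0 : c p != 0 by rewrite -normr_gt0.
pose S := \sum_i `|c (lift p i)|.
have S0 : 0 <= S by apply: sumr_ge0.
(* Mesh [1 / N]: moving the coordinates other than [p] inside a cell changes the form by at most
   [S / N <= d]. *)
pose N := (Num.truncn (S / d)).+1.
have SN : S / N%:R <= d.
  by rewrite ler_pdivrMr // mulrC -ler_pdivrMr // ltW // truncnS_gt.
(* The relevant integer lies within [|c p| + 2 * d + 1 <= |c p| + 3] of [Num.floor (off g)], so
   shifts from [-L] to [L] suffice. *)
pose L := (Num.truncn `|c p| + 4)%N.
have L1 : `|c p| + 3 <= L%:R.
  rewrite /L natrD; have := truncnS_gt `|c p|; rewrite -natr1; lra.
have L2 : L%:R <= `|c p| + 4.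
  have : (Num.truncn `|c p|)%:R <= `|c p| by rewrite truncn_le.
  by rewrite /L natrD; lra.
pose off (g : {ffun 'I_m -> 'I_N}) : R := \sum_i (g i)%:R / N%:R * c (lift p i).
(* The value of coordinate [p] at which the form equals the integer coded by [f.2], the other
   coordinates being at the lower corner of the cell [f.1]. *)
pose ctr (f : {ffun 'I_m -> 'I_N} * 'I_(L.*2.+1)) : R :=
  ((Num.floor (off f.1) + f.2%:Z - L%:Z)%:~R - off f.1) / c p.
pose box (f : {ffun 'I_m -> 'I_N} * 'I_(L.*2.+1)) : 'M[R]_(1, m.+1) * 'M[R]_(1, m.+1) :=
  (\row_i (if unlift p i is Some i' then (f.1 i')%:R / N%:R
           else ctr f - 2 * d / `|c p|),
   \row_i (if unlift p i is Some i' then (f.1 i').+1%:R / N%:R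
           else ctr f + 2 * d / `|c p|)).
exists (codom box) => [t [t01 td]|].
  have [g gP] := @choice _ _
    (fun i (g : 'I_N) => g%:R / N%:R <= t ord0 (lift p i) <= g.+1%:R / N%:R)
    (fun i => grid_cell _ (t01 (lift p i))).
  have [y _ ty] := dist_int_nearest (\sum_i t ord0 i * c i).
  rewrite {}ty in td.
  pose u := off (finfun g).
  (* One [d] comes from the distance to the nearest integer, the other from rounding to the grid. *)
  have uE : `|t ord0 p * c p + u - y%:~R| <= 2 * d.
    have -> : t ord0 p * c p + u - y%:~R = (\sum_i t ord0 i * c i - y%:~R)
      - \sum_i (t ord0 (lift p i) - (g i)%:R / N%:R) * c (lift p i).
      have -> : \sum_i (t ord0 (lift p i) - (g i)%:R / N%:R) * c (lift p i) =
                \sum_i t ord0 (lift p i) * c (lift p i) - u.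
        by rewrite /u /off -sumrB; apply: eq_bigr => i _; rewrite ffunE mulrBl.
      by rewrite (bigD1_ord p) //=; ring.
    apply: le_trans (ler_normB _ _) _.
    suff : `|\sum_i (t ord0 (lift p i) - (g i)%:R / N%:R) * c (lift p i)| <= S / N%:R.
      by move: td SN; lra.
    apply: le_trans (ler_norm_sum _ _ _) _.
    rewrite /S mulr_suml; apply: ler_sum => i _.
    rewrite normrM mulrC ler_wpM2l //.
    have /andP[lo hi] := gP i; rewrite ger0_norm ?subr_ge0 //.
    by move: hi; rewrite -natr1 mulrDl mul1r; lra.
  have yu : `|y%:~R - u| <= `|c p| + 2 * d.
    have : `|t ord0 p * c p| <= `|c p|.
      rewrite normrM ger0_norm; last by case/andP: (t01 p) => /ltW.
      by rewrite ler_piMl //; case/andP: (t01 p) => _ /ltW.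
    rewrite !ler_norml; move: uE; rewrite !ler_norml; lra.
  have yL : 0 <= y - Num.floor u + L%:Z <= (L.*2)%:Z.
    have /andP[fl1 fl2] := floor_itv u; rewrite intrD in fl2.
    rewrite -!(ler_int R) !intrD intrN -!pmulrn -muln2 natrM.
    move: yu; rewrite ler_norml; lra.
  have lL : (`|(y - Num.floor u + L%:Z)%R| < L.*2.+1)%N by lia.
  exists (box (finfun g, Ordinal lL)); first exact: codom_f.
  move=> j i; rewrite ord1 !mxE /=.
  case: unliftP => [i' ->|->]; first by rewrite ffunE; exact: gP.
  have -> : ctr (finfun g, Ordinal lL) = (y%:~R - u) / c p.
    by rewrite /ctr /=; congr ((_%:~R - _) / _); rewrite -/u; lia.
  have : `|t ord0 p - (y%:~R - u) / c p| <= 2 * d / `|c p|.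
    rewrite ler_pdivlMr // -normrM mulrBl divfK //.
    by have -> : t ord0 p * c p - (y%:~R - u) = t ord0 p * c p + u - y%:~R by ring.
  rewrite ler_norml; lra.
rewrite big_map big_enum /=.
have volE f : mx_box_volume (box f).1 (box f).2 = (4 * d / `|c p|) * N%:R^-1 ^+ m.
  rewrite /mx_box_volume big_ord1 (bigD1_ord p) //= !mxE unlift_none.
  rewrite [Num.max _ _]max_r; last first.
    by have := divr_ge0 (ltW d0) (ltW cp0); rewrite -!mulrA; lra.
  congr (_ * _); first by rewrite -!mulrA; ring.
  rewrite (eq_bigr (fun=> N%:R^-1)) ?prodr_const ?card_ord // => i _.
  rewrite !mxE liftK max_r; last first.
    by rewrite -mulrBl divr_ge0 // -natr1 addrC addKr.
  by rewrite -mulrBl -natr1 addrC addKr mul1r.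
rewrite (eq_bigr _ (fun f _ => volE f)) sumr_const card_prod card_ffun !card_ord.
rewrite -[leLHS]mulr_natl natrM natrX.
have -> : N%:R ^+ m * (L.*2.+1)%:R * (4 * d / `|c p| * N%:R^-1 ^+ m) =
          4 * d * (L.*2.+1)%:R / `|c p| :> R.
  by rewrite exprVn; field; rewrite (gt_eqF cp0) expf_neq0 ?pnatr_eq0.
have -> : (L.*2.+1)%:R = L%:R * 2 + 1 :> R by rewrite -muln2 -natrM natr1.
(* From [L <= |c p| + 4] and [1 / 2 <= |c p|], the ratio [(2 * L + 1) / |c p|] is at most
   [2 + 9 / |c p| <= 20], whence the constant 80. *)
rewrite ler_pdivrMr //; nra.
Qed.

End Slabs.

(** * Generic parameters *)

Definition int_cube (d C : nat) : seq 'rV[int]_d :=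
  codom (fun f : {ffun 'I_d -> 'I_(C.*2.+1)} => \row_i ((f i)%:Z - C%:Z)).

Lemma size_int_cube d C : size (int_cube d C) = (C.*2.+1 ^ d)%N.
Proof. by rewrite /int_cube size_codom card_ffun !card_ord. Qed.

Lemma mem_int_cube d C (x : 'rV[int]_d) :
  (forall i, (`|x ord0 i| <= C)%N) -> x \in int_cube d C.
Proof.
move=> xC.
have lt i : (`|(x ord0 i + C%:Z)%R| < C.*2.+1)%N by have := xC i; lia.
apply/codomP; exists [ffun i => Ordinal (lt i)].
by apply/rowP => i; rewrite mxE ffunE -[x 0 i]/(x ord0 i) /=; have := xC i; lia.
Qed.

Section Norms.
Context {R : realType} {m n : nat}.
Implicit Types (Theta : 'M[R]_(n, m)) (x : 'rV[int]_m).

Lemma leq_maxnorm x i : (`|x ord0 i| <= maxnorm x)%N.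
Proof. exact: (leq_bigmax (F := fun i => `|x ord0 i|%N)). Qed.

Lemma maxnorm_leq x (Q : nat) :
  (forall i, (`|x ord0 i| <= Q)%N) -> (maxnorm x <= Q)%N.
Proof. by move=> xQ; apply/bigmax_leqP => i _. Qed.

Lemma dist_int_le_zeta Theta j x :
  dist_int (linform Theta j x) <= zeta Theta x.
Proof. exact: le_bigmax. Qed.

Lemma zeta_le Theta x (d : R) : 0 <= d ->
  (forall j, dist_int (linform Theta j x) <= d) -> zeta Theta x <= d.
Proof. by move=> d0 xd; apply: bigmax_le. Qed.

End Norms.

(** * Almost every parameter is generic *)

Section GenericPart.
Context {R : realType} {m n : nat}.
Implicit Types (xi : R) (x : 'rV[int]_m.+2) (T : 'M[R]_(n, m.+1)).

(* coef xi x i is the coefficient of the free entry T j i in L_j(x). *)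
Definition coef xi x (i : 'I_m.+1) : R :=
  (x ord0 (lift 1 i))%:~R - (if i == ord0 then xi * (x ord0 1)%:~R else 0).

Lemma linform_dependent xi T j x :
  linform (dependent_mx xi T) j x = \sum_i T j i * coef xi x i.
Proof.
rewrite /linform (bigD1_ord 1) //= mxE unlift_none.
rewrite (eq_bigr (fun i => T j i * (x ord0 (lift 1 i))%:~R)); last first.
  by move=> i _; rewrite mxE liftK.
rewrite !(bigD1_ord ord0) //= /coef eqxx.
rewrite (eq_bigr (fun i => T j (lift ord0 i) * coef xi x (lift ord0 i))); last first.
  by move=> i _; rewrite /coef eq_sym (negbTE (neq_lift _ _)) subr0.
by rewrite /coef; ring.
Qed.

(** The threshold 1/2 serves twice: it bounds the slab estimate uniformly in [x], and below it the
    integer coefficients vanish while the first one is too small for the forms to wrap around modulo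
    1. *)
Definition far xi x : Prop := exists i, 1 / 2 <= `|coef xi x i|.

(** Allowing every [Q >= maxnorm x], and not only equality, lets one convergent be compared with all
    far vectors of no larger norm, including the short ones. *)
Definition generic xi T : Prop :=
  exists Q0 : nat, forall Q x, (Q0 <= Q)%N -> far xi x -> (maxnorm x <= Q)%N ->
    Q%:R^-1 < zeta (dependent_mx xi T) x.

Lemma admissible_itv T j i : admissible T -> 0 < T j i < 1.
Proof.
move=> [T0 T1]; have [->|i0] := eqVneq i ord0; last exact: T1.
by have := T0 j; case: ifP => _; lra.
Qed.

(** All rows of [T] satisfy the same slab condition, because the coefficients of [L_j] do not depend
    on [j]. *)
Lemma coverable_far_approx xi x (d : R) : 0 < d <= 1 -> far xi x ->
  coverable [set T : 'M[R]_(n, m.+1) | admissible T /\ zeta (dependent_mx xi T) x <= d]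
    ((80 * d) ^+ n).
Proof.
move=> d01 [p xp].
apply: coverable_sub _ (lexx _) (coverable_rows n (coverable_slab xp d01)) => T.
move=> [Ta Td] j /=; split=> [i|]; first by rewrite mxE; exact: admissible_itv.
apply: le_trans Td; apply: le_trans (dist_int_le_zeta _ j _).
rewrite linform_dependent le_eqVlt; apply/orP; left; apply/eqP; congr dist_int.
by apply: eq_bigr => i _; rewrite mxE.
Qed.

Lemma almost_all_generic xi : (m.+2 < n)%N ->
  almost_all_in (@admissible R m n) (generic xi).
Proof.
move=> mn.
(* Dyadic scales: a violation at [Q] with [2 ^ l <= Q < 2 ^ l.+1] falls into [A l], since then
   [1 / Q <= 1 / 2 ^ l]. *)
pose A l := [set T : 'M[R]_(n, m.+1) | admissible T /\ exists x, [/\ far xi x,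
  (maxnorm x <= 2 ^ l.+1)%N & zeta (dependent_mx xi T) x <= (2 ^+ l)^-1]].
apply: (@lebesgue_outer_limsup R n m.+1 A (8 ^+ m.+2 * 80 ^+ n)) => //.
- by apply: leq_trans mn.
- move=> l.
  have e0 : 0 < (2 ^+ l)^-1 :> R by rewrite invr_gt0 exprn_gt0.
  have e1 : (2 ^+ l)^-1 <= 1 :> R by rewrite invf_le1 ?exprn_gt0 ?exprn_ege1 ?ler1n.
  pose v : R := (80 * (2 ^+ l)^-1) ^+ n.
  have v0 : 0 <= v by rewrite exprn_ge0 // mulr_ge0 // ltW.
  (* With [a = 2 ^+ l] this is [a ^+ M.+1 <= a ^+ n]; the gap between [n] and the number of columns
     yields the summable factor. *)
  have key M : (M < n)%N -> (8 * 2 ^+ l) ^+ M * v <= 8 ^+ M * 80 ^+ n / 2 ^+ l.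
    move=> Mn; rewrite /v !exprMn -!mulrA ler_wpM2l ?exprn_ge0 // mulrCA.
    rewrite ler_wpM2l ?exprn_ge0 //.
    set a : R := 2 ^+ l; have a0 : 0 < a by rewrite exprn_gt0.
    rewrite exprVn ler_pdivrMr ?exprn_gt0 // mulrC ler_pdivlMr // -exprSr.
    by rewrite ler_weXn2l ?exprn_ege1 ?ler1n.
  pose s := int_cube m.+2 (2 ^ l.+1).
  (* Putting [far xi x] inside makes the set empty, and covered by no box, for the other vectors of
     the cube. *)
  pose F x := [set T : 'M[R]_(n, m.+1) | far xi x /\ (admissible T /\
    zeta (dependent_mx xi T) x <= (2 ^+ l)^-1)].
  apply: (@coverable_sub _ _ _ _ (\bigcup_(x in [set` s]) F x) ((size s)%:R * v)).
  + move=> T [Ta [x [xfar xl xz]]]; exists x => //=; apply: mem_int_cube => i.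
    exact: leq_trans (leq_maxnorm _ _) xl.
  + rewrite size_int_cube.
    (* The side of the cube has [2 * 2 ^ l.+1 + 1 <= 8 * 2 ^ l] integers. *)
    apply: (@le_trans _ _ ((8 * 2 ^+ l) ^+ m.+2 * v)).
      rewrite ler_wpM2r // natrX lerXn2r ?nnegrE ?mulr_ge0 ?exprn_ge0 //.
      rewrite -natrX -natrM ler_nat expnS.
      have : (0 < 2 ^ l)%N by rewrite expn_gt0.
      by lia.
    exact: key mn.
  + apply: coverable_bigcup => // x _.
    have [xfar|xfar] := pselect (far xi x); last by exists [::] => [T []|]; rewrite ?big_nil.
    by apply: coverable_sub _ (lexx _) (coverable_far_approx _ xfar); rewrite ?e0 // => T [].
- move=> N T [Ta Tng]; apply: contra_notP Tng => TA.
  exists (2 ^ N)%N => Q x NQ xfar xQ; rewrite ltNge; apply/negP => xz.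
  have Q0 : (0 < Q)%N by apply: leq_trans NQ; rewrite expn_gt0.
  have /andP[lQ Ql] := trunc_log_bounds (isT : 1 < 2)%N Q0.
  apply: TA; exists (trunc_log 2 Q); first exact: trunc_log_max.
  split=> //; exists x; split=> //; first exact: leq_trans xQ (ltnW Ql).
  by apply: le_trans xz _; rewrite lef_pV2 ?posrE ?exprn_gt0 ?ltr0n // -natrX ler_nat.
Qed.

End GenericPart.

(** * Continued fractions *)

Section ContinuedFractionTheory.
Context {R : realType}.
Variable xi : R.
Hypotheses (hxi : 0 < xi < 1) (xi_irr : irrational xi).
Implicit Types (k : nat) (p q : int).

Let D k : R := (cf_den xi k)%:~R * xi - (cf_num xi k)%:~R.
Let frac k : R := cf_tail xi k - (cf_quotient xi k)%:~R.

(** Undoing a step carries rationality back to [xi]. Hence no tail is an integer and the inverse in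
    [cf_tail] is never taken at 0. *)
Lemma cf_tail_irrational k : irrational (cf_tail xi k).
Proof.
elim: k => [//|k IHk] /= [r _ rE]; apply: IHk.
exists (r^-1 + (Num.floor (cf_tail xi k))%:~R) => //.
by rewrite rmorphD /= fmorphV ratr_int /= rE invrK subrK.
Qed.

Lemma cf_frac_itv k : 0 < frac k < 1.
Proof.
have /andP[lo hi] := floor_itv (cf_tail xi k); rewrite intrD in hi.
rewrite /frac /cf_quotient lt_neqAle subr_ge0 lo ltrBlDl addrC andbT andbC.
rewrite addrC hi /= eq_sym subr_eq0; apply/eqP => tE.
apply: (@cf_tail_irrational k); rewrite tE.
by exists (Num.floor (cf_tail xi k))%:~R; rewrite ?ratr_int.
Qed.

Lemma cf_tailS k : cf_tail xi k.+1 = (frac k)^-1.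
Proof. by []. Qed.

Lemma cf_quotientS_ge1 k : 1 <= cf_quotient xi k.+1.
Proof.
have /andP[f0 f1] := cf_frac_itv k.
by rewrite /cf_quotient Num.Theory.floor_ge_int cf_tailS invf_ge1 // ltW.
Qed.

Lemma cf_quotient0 : cf_quotient xi 0 = 0.
Proof. by apply: floor_def; rewrite add0r; case/andP: hxi => /ltW-> ->. Qed.

Lemma cf_num0 : cf_num xi 0 = 0. Proof. exact: cf_quotient0. Qed.

Lemma cf_den0 : cf_den xi 0 = 1. Proof. by []. Qed.

Lemma cf_num1 : cf_num xi 1 = 1.
Proof. by rewrite /cf_num /= cf_quotient0 mulr0 add0r. Qed.

Lemma cf_den1 : cf_den xi 1 = cf_quotient xi 1.
Proof. by rewrite /cf_den /= mulr1 addr0. Qed.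

Lemma cf_numSS k : cf_num xi k.+2 =
  cf_quotient xi k.+2 * cf_num xi k.+1 + cf_num xi k.
Proof. by rewrite /cf_num /=; case: (cf_pair xi k) => [[? ?] [? ?]]. Qed.

Lemma cf_denSS k : cf_den xi k.+2 =
  cf_quotient xi k.+2 * cf_den xi k.+1 + cf_den xi k.
Proof. by rewrite /cf_den /=; case: (cf_pair xi k) => [[? ?] [? ?]]. Qed.

Lemma cf_den_ge1 k : 1 <= cf_den xi k.
Proof.
suff : 1 <= cf_den xi k /\ 1 <= cf_den xi k.+1 by case.
elim: k => [|k [dk dk1]]; first by rewrite cf_den0 cf_den1 cf_quotientS_ge1.
by split=> //; rewrite cf_denSS; have := cf_quotientS_ge1 k.+1; nia.
Qed.

(** Strict growth starts at index 1: the denominators of index 0 and 1 are both 1 when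
    [xi > 1 / 2]. *)
Lemma ltr_cf_den k : cf_den xi k.+1 < cf_den xi k.+2.
Proof.
rewrite cf_denSS; have := cf_den_ge1 k; have := cf_den_ge1 k.+1.
by have := cf_quotientS_ge1 k.+1; nia.
Qed.

Lemma ler_cf_den k : cf_den xi k <= cf_den xi k.+1.
Proof.
by case: k => [|k]; [rewrite cf_den0 cf_den_ge1|exact/ltW/ltr_cf_den].
Qed.

Lemma cf_den_unbounded k : k%:Z <= cf_den xi k.
Proof.
elim: k => [|k IHk]; first by rewrite cf_den0.
by case: k IHk => [_|k IHk]; [exact: cf_den_ge1|have := ltr_cf_den k; lia].
Qed.

Lemma cf_det k :
  cf_num xi k.+1 * cf_den xi k - cf_num xi k * cf_den xi k.+1 = (-1) ^+ k.
Proof.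
elim: k => [|k IHk]; first by rewrite cf_num1 cf_num0 cf_den0 mul0r subr0.
by rewrite cf_numSS cf_denSS exprS -IHk; ring.
Qed.

(** The errors obey the recurrence of the denominators, and the previous instance gives
    [D k = - cf_tail xi k.+2 * D k.+1]; what remains of the tail is its fractional part. *)
Lemma cf_errS k : D k.+1 = - frac k.+1 * D k.
Proof.
elim: k => [|k IHk].
  have /andP[f0 _] := cf_frac_itv 0.
  have fE : frac 0 = xi by rewrite /frac cf_quotient0 subr0.
  rewrite /frac cf_tailS fE /D cf_den1 cf_num1 cf_den0 cf_num0; field.
  by rewrite gt_eqF //; case/andP: hxi.
have -> : D k.+2 = (cf_quotient xi k.+2)%:~R * D k.+1 + D k.
  by rewrite /D cf_denSS cf_numSS; ring.
have /andP[f0 _] := cf_frac_itv k.+1.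
have -> : D k = - cf_tail xi k.+2 * D k.+1.
  by rewrite IHk cf_tailS; field; rewrite gt_eqF.
by rewrite /frac; ring.
Qed.

Lemma cf_err_alternate k : D k * D k.+1 < 0.
Proof.
have D0 : D k != 0.
  elim: k => [|k IHk].
    by rewrite /D cf_den0 cf_num0 subr0 mul1r gt_eqF //; case/andP: hxi.
  by rewrite cf_errS mulf_neq0 // oppr_eq0 gt_eqF //; case/andP: (cf_frac_itv k.+1).
rewrite cf_errS mulNr mulrN oppr_lt0 mulrCA -expr2 mulr_gt0 ?exprn_even_gt0 //.
by case/andP: (cf_frac_itv k.+1).
Qed.

(** Consecutive errors have opposite signs, so the determinant identity becomes
    [q_(k+1) |D k| + q_k |D k.+1| = 1], with a positive second term. *)
Lemma cf_err_lt k : `|D k| < (cf_den xi k.+1)%:~R^-1.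
Proof.
have q1 : 1 <= (cf_den xi k.+1)%:~R :> R by rewrite (ler_int _ 1) cf_den_ge1.
have q0 : 1 <= (cf_den xi k)%:~R :> R by rewrite (ler_int _ 1) cf_den_ge1.
have DD := cf_err_alternate k.
have : `|(cf_den xi k.+1)%:~R * D k - (cf_den xi k)%:~R * D k.+1| = 1.
  have -> : (cf_den xi k.+1)%:~R * D k - (cf_den xi k)%:~R * D k.+1 =
            ((-1) ^+ k : int)%:~R by rewrite -cf_det /D; ring.
  by rewrite rmorphXn /= normrX rmorphN normrN1 expr1n.
rewrite -[_^-1]mul1r ltr_pdivlMr; last by lra.
have [Dp|Dn] := ltP 0 (D k).
  have Dn : D k.+1 < 0 by rewrite -(pmulr_rlt0 _ Dp).
  rewrite (gtr0_norm Dp) ger0_norm; nra.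
have Dn' : D k < 0 by rewrite lt_neqAle Dn andbT; apply: contraTneq DD => ->; rewrite mul0r ltxx.
have Dp : 0 < D k.+1 by rewrite -(nmulr_rlt0 _ Dn').
rewrite (ltr0_norm Dn') ler0_norm; nra.
Qed.

Lemma normrD_same_sign (x y : R) : 0 <= x * y -> `|x + y| = `|x| + `|y|.
Proof.
move=> xy; have [x0|x0] := leP 0 x; have [y0|y0] := leP 0 y.
- by rewrite !ger0_norm ?addr_ge0.
- have -> : x = 0 by apply/eqP; rewrite eq_le x0 andbT -(nmulr_lge0 _ y0).
  by rewrite normr0 !add0r.
- have -> : y = 0 by apply/eqP; rewrite eq_le y0 andbT -(nmulr_rge0 _ x0).
  by rewrite normr0 !addr0.
- by rewrite !ltr0_norm ?opprD // -subr_gt0; lra.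
Qed.

(** Expand [(p, q)] in the basis of convergents [k] and [k.+1] with integer coefficients [u], [v].
    The bound on [q] forces [v = 0] or [u * v < 0]; in the latter case the alternating errors add up
    to more than [|D k|]. *)
Lemma cf_best_approx k p q : `|q| < cf_den xi k.+1 -> (p != 0) || (q != 0) ->
  `|D k| <= `|q%:~R * xi - p%:~R| /\
  (`|q%:~R * xi - p%:~R| <= `|D k| ->
   exists2 s : int, s = 1 \/ s = -1 & p = s * cf_num xi k /\ q = s * cf_den xi k).
Proof.
move=> qk pq0.
pose e : int := (-1) ^+ k.
have e2 : e * e = 1 by rewrite /e -exprMn mulrNN mulr1 expr1n.
have eE := cf_det k; rewrite -/e in eE.
(* Cramer's rule; the determinant [e] is its own inverse. *)
pose u := e * (q * cf_num xi k.+1 - p * cf_den xi k.+1).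
pose v := e * (p * cf_den xi k - q * cf_num xi k).
have pE : p = u * cf_num xi k + v * cf_num xi k.+1.
  by rewrite -[LHS]mulr1 -e2 -[X in _ * (_ * X)]eE /u /v; ring.
have qE : q = u * cf_den xi k + v * cf_den xi k.+1.
  by rewrite -[LHS]mulr1 -e2 -[X in _ * (_ * X)]eE /u /v; ring.
clearbody u v.
have DE : q%:~R * xi - p%:~R = u%:~R * D k + v%:~R * D k.+1.
  by rewrite {1}pE {1}qE /D; ring.
have DD := cf_err_alternate k.
have Dk0 : 0 < `|D k| by rewrite normr_gt0; apply: contraTneq DD => ->; rewrite mul0r ltxx.
have Dk1 : 0 < `|D k.+1| by rewrite normr_gt0; apply: contraTneq DD => ->; rewrite mulr0 ltxx.
have dk := cf_den_ge1 k; have dk1 := cf_den_ge1 k.+1.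
rewrite DE.
have [v0|v0] := eqVneq v 0.
  have u0 : u != 0.
    by apply: contraTneq pq0 => u0; rewrite pE qE u0 v0 !mul0r addr0 eqxx.
  rewrite v0 mul0r addr0 normrM -intr_norm.
  have u1 : 1 <= `|u|%:~R :> R by rewrite (ler_int _ 1); lia.
  split; first by rewrite ler_peMl // ltW.
  rewrite -ler_pdivlMr // divff ?gt_eqF // (ler_int _ _ 1) => u1'.
  by exists u; [lia|rewrite {1}pE {1}qE v0 !mul0r !addr0].
have uv : u * v < 0.
  rewrite ltNge; apply/negP => uv0.
  suff : cf_den xi k.+1 <= `|q| by lia.
  rewrite qE; set a := cf_den xi k in dk *; set b := cf_den xi k.+1 in dk1 *.
  have a0 : 0 <= a by lia.
  have b0 : 0 <= b by lia.
  have [vp|vn] := ltP 0 v.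
    have u0 : 0 <= u by rewrite -(pmulr_lge0 _ vp).
    have : 0 <= u * a by rewrite mulr_ge0.
    have : 1 * b <= v * b by rewrite ler_wpM2r //; lia.
    by lia.
  have vn' : v < 0 by rewrite lt_neqAle v0 vn.
  have u0 : u <= 0 by rewrite -(nmulr_lge0 _ vn').
  have : u * a <= 0 by rewrite mulr_le0_ge0.
  have : v * b <= -1 * b by rewrite ler_wpM2r //; lia.
  by lia.
rewrite (@normrD_same_sign (u%:~R * D k)); last first.
  by rewrite mulrACA -intrM ltW // nmulr_rgt0 // (ltr_int _ _ 0).
rewrite !normrM -!intr_norm.
have u1 : 1 <= `|u|%:~R :> R by rewrite (ler_int _ 1); nia.
have v1 : 1 <= `|v|%:~R :> R by rewrite (ler_int _ 1); nia.
split; nra.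
Qed.

(** Thus the norm of a convergent vector is its denominator. An error below 1 and [0 < xi < 1] give
    [-1 < p < q + 1]. *)
Lemma cf_num_itv k : 0 <= cf_num xi k <= cf_den xi k.
Proof.
have q1 : 1 <= (cf_den xi k.+1)%:~R :> R by rewrite (ler_int _ 1) cf_den_ge1.
have q0 : 1 <= (cf_den xi k)%:~R :> R by rewrite (ler_int _ 1) cf_den_ge1.
have : `|D k| < 1.
  by apply: lt_le_trans (cf_err_lt k) _; rewrite invf_le1 //; lra.
rewrite ltr_norml /D -!ltzD1 -[0 < _]ltrBlDr sub0r -!(ltr_int R) !intrD => /andP[].
by case/andP: hxi => *; apply/andP; split; nra.
Qed.

Lemma cf_den_bracket (Q : nat) : (0 < Q)%N ->
  exists k, cf_den xi k <= Q%:Z < cf_den xi k.+1.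
Proof.
move=> Q0.
have ex : exists k, Q%:Z < cf_den xi k.
  by exists Q.+1; have := cf_den_unbounded Q.+1; lia.
case: (ex_minnP ex) => -[|k]; first by rewrite cf_den0; lia.
by move=> Qk kmin; exists k; rewrite Qk andbT leNgt; apply/negP => /kmin; rewrite ltnn.
Qed.

End ContinuedFractionTheory.

(** * Enumerations up to sign *)

Section Enumerations.
Context {d : nat} (E : set 'rV[int]_d) (M : 'rV[int]_d -> nat).
Implicit Types (u v : 'rV[int]_d) (z w : nat -> 'rV[int]_d).

(** Abstract form of [best_approx_seq], which is the case where [E] is [ext_best_approx Theta] and
    [M] is the norm of the left block. *)
Definition enumeration z : Prop :=
  [/\ forall nu, E (z nu),
      forall v, E v -> exists nu, v = z nu \/ v = - z nu,
      forall mu nu, (mu < nu)%N -> z mu <> z nu /\ z mu <> - z nu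
    & forall nu, (M (z nu) <= M (z nu.+1))%N].

Variables (w : nat -> 'rV[int]_d) (K : nat).
Hypothesis MN : forall v, M (- v) = M v.
Hypothesis w_E : forall k, (K <= k)%N -> E (w k).
Hypothesis w_lt : forall k, (K <= k)%N -> (M (w k) < M (w k.+1))%N.
Hypothesis E_w : forall v, E v -> (M (w K) <= M v)%N ->
  exists2 k, (K <= k)%N & v = w k \/ v = - w k.

Lemma M_opp u v : u = v \/ u = - v -> M u = M v.
Proof. by move=> [->|->]. Qed.

Lemma w_mono i j : (M (w (K + i)) < M (w (K + j)))%N = (i < j)%N.
Proof.
pose g i := M (w (K + i)); suff gh : {homo g : i j / (i < j)%N}.
  exact: (leqW_mono (leq_mono gh)).
apply: homo_ltn => [y x t|k]; first exact: ltn_trans.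
by rewrite /g addnS; apply: w_lt; rewrite leq_addr.
Qed.

(** Induction from the place where [w K] occurs: the next vector of [w] occurs later in [z], so
    monotonicity squeezes the next term of [z] between two consecutive vectors of [w], and repeating
    the first one up to sign is excluded. *)
Lemma enumeration_tail z : enumeration z ->
  exists N, forall nu, z (N + nu)%N = w (K + nu)%N \/ z (N + nu)%N = - w (K + nu)%N.
Proof.
move=> [zE Ez z_inj z_le].
have zM i j : (i <= j)%N -> (M (z i) <= M (z j))%N.
  pose g i := M (z i); suff gM : {homo g : i j / (i <= j)%N} by exact: gM.
  by apply: homo_leq => // y x t; exact: leq_trans.
have [N wN] := Ez _ (w_E (leqnn K)).
exists N; elim=> [|nu IHnu].
  by rewrite !addn0; case: wN => ->; [left|right; rewrite opprK].
have [mu wmu] := Ez _ (w_E (leq_addr nu.+1 K)).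
have Mmu : M (z mu) = M (w (K + nu.+1)%N) by rewrite (M_opp wmu).
have Mnu := M_opp IHnu.
have mu_gt : (N + nu < mu)%N.
  rewrite ltnNge; apply/negP => /zM; rewrite Mmu Mnu leqNgt w_mono.
  by rewrite ltnSn.
rewrite addnS; move: mu_gt; rewrite leq_eqVlt => /orP[/eqP ->|mu_gt].
  by case: wmu => ->; [left|right; rewrite opprK].
have le1 := zM _ _ (leqnSn (N + nu)).
have le2 := zM _ _ (ltnW mu_gt).
have [|j Kj zj] := E_w (zE (N + nu).+1).
  rewrite (leq_trans _ le1) // Mnu -{1}[K]addn0 leqNgt w_mono //.
move: zj; rewrite -(subnKC Kj); set i := (j - K)%N => zj.
rewrite (M_opp zj) Mnu leqNgt w_mono -leqNgt in le1.
rewrite (M_opp zj) Mmu leqNgt w_mono -leqNgt in le2.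
move: le1; rewrite leq_eqVlt => /orP[/eqP nui|nui]; last first.
  by have <- : i = nu.+1 by apply/eqP; rewrite eqn_leq le2.
have [ne1 ne2] := z_inj _ _ (ltnSn (N + nu)).
rewrite -nui in zj.
by case: IHnu zj ne1 ne2 => -> [->|->]; rewrite ?opprK.
Qed.

Hypothesis EN : forall v, E v -> E (- v).

(* From each pair {v, -v} keep the vector with the smaller code (pickle). *)
Lemma exists_enumeration (F : seq 'rV[int]_d) :
  (forall v, E v -> (M v < M (w K))%N -> v \in F) -> exists z, enumeration z.
Proof.
move=> E_F.
pose small v := `[< E v /\ (M v < M (w K))%N >] && (pickle v <= pickle (- v))%N.
pose s := sort (relpre M leq) (undup [seq v <- F | small v]).
have sE v : (v \in s) = small v.
  rewrite mem_sort mem_undup mem_filter; case sv : (small v) => //=.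
  by case/andP: sv => /asboolP[Ev Mv] _; rewrite E_F.
have s_uniq : uniq s by rewrite sort_uniq undup_uniq.
have s_sorted : sorted (relpre M leq) s.
  by apply: sort_sorted => u v; exact: leq_total.
(* The finitely many vectors below [w K], sorted by [M], are followed by the tail of [w]. *)
pose z nu := if (nu < size s)%N then nth 0 s nu else w (K + (nu - size s))%N.
have z_lt nu : (nu < size s)%N -> small (z nu).
  by move=> nus; rewrite /z nus -sE mem_nth.
have z_ge nu : (size s <= nu)%N -> z nu = w (K + (nu - size s))%N.
  by move=> nus; rewrite /z ltnNge nus.
have wK nu : (M (w K) <= M (w (K + nu)%N))%N.
  by rewrite -{1}[K]addn0 leqNgt w_mono.
exists z; split=> [nu|v Ev|mu nu munu|nu].
- case: (ltnP nu (size s)) => nus; last first.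
    by rewrite z_ge //; apply: w_E; rewrite leq_addr.
  by have /andP[/asboolP[]] := z_lt _ nus.
- case: (leqP (M (w K)) (M v)) => Mv.
    have [k Kk vk] := E_w Ev Mv; exists (size s + (k - K))%N.
    by rewrite z_ge ?leq_addr // addKn subnKC.
  have in_s u : E u -> (M u < M (w K))%N -> (pickle u <= pickle (- u))%N ->
      exists nu, u = z nu.
    move=> Eu Mu pu; have us : u \in s by rewrite sE /small pu andbT; apply/asboolP.
    by exists (index u s); rewrite /z index_mem us nth_index.
  have [pv|pv] := leqP (pickle v) (pickle (- v)).
    by have [nu ->] := in_s v Ev Mv pv; exists nu; left.
  have [||nu nuE] := in_s (- v) (EN Ev); first by rewrite MN.
    by rewrite opprK ltnW.
  by exists nu; right; rewrite -nuE opprK.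
- case: (ltnP nu (size s)) => nus.
    have mus := ltn_trans munu nus.
    have zne : z mu <> z nu.
      rewrite /z mus nus => /eqP; rewrite nth_uniq // => /eqP munuE.
      by rewrite munuE ltnn in munu.
    split=> // zN; apply: zne.
    (* Two opposite vectors that are both minimal in their pair have equal codes, hence coincide. *)
    have /andP[_ p1] := z_lt _ mus; have /andP[_ p2] := z_lt _ nus.
    apply: (pcan_inj pickleK); apply/eqP; rewrite eqn_leq; apply/andP; split.
      by rewrite zN in p1 *; rewrite opprK in p1.
    by rewrite zN.
  suff Mlt : (M (z mu) < M (z nu))%N.
    by split=> zmu; move: Mlt; rewrite zmu ?MN ltnn.
  rewrite (z_ge nu nus); case: (ltnP mu (size s)) => mus; last first.
    by rewrite (z_ge mu mus) w_mono ltn_sub2r // (leq_ltn_trans mus).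
  have /andP[/asboolP[_ Mmu] _] := z_lt _ mus.
  exact: leq_trans Mmu (wK _).
- case: (ltnP nu.+1 (size s)) => nus.
    rewrite /z nus (ltnW nus).
    apply: (sorted_leq_nth _ _ 0 s_sorted) => //; rewrite ?inE ?(ltnW nus) //.
      by move=> a b c; exact: leq_trans.
    by move=> a; exact: leqnn.
  rewrite (z_ge nu.+1 nus); case: (ltnP nu (size s)) => nus'; last first.
    by rewrite (z_ge nu nus') leqNgt w_mono -leqNgt leq_sub2r.
  have /andP[/asboolP[_ Mmu] _] := z_lt _ nus'.
  exact: leq_trans (ltnW Mmu) (wK _).
Qed.

End Enumerations.

(** * Best approximations of a generic matrix of the family *)

Section Symmetry.
Context {R : realType} {m n : nat}.
Implicit Types (Theta : 'M[R]_(n, m)) (x : 'rV[int]_m).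

Lemma dist_intN (t : R) : dist_int (- t) = dist_int t.
Proof.
have [y ty ->] := dist_int_nearest t.
have tyN : `|- t - (- y)%:~R| = `|t - y%:~R| by rewrite intrN -opprD normrN.
by rewrite (@dist_intE _ _ (- y)) tyN.
Qed.

Lemma maxnormN x : maxnorm (- x) = maxnorm x.
Proof. by apply: eq_bigr => i _; rewrite mxE abszN. Qed.

Lemma linformN Theta j x : linform Theta j (- x) = - linform Theta j x.
Proof.
by rewrite /linform -sumrN; apply: eq_bigr => i _; rewrite mxE intrN mulrN.
Qed.

Lemma zetaN Theta x : zeta Theta (- x) = zeta Theta x.
Proof. by apply: eq_bigr => j _; rewrite linformN dist_intN. Qed.

Lemma best_approxN Theta x : best_approx Theta x -> best_approx Theta (- x).
Proof.
by case=> x0 xb; split=> [|x' x'0]; rewrite ?oppr_eq0 // maxnormN zetaN; exact: xb.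
Qed.

Lemma ext_best_approxN Theta (v : 'rV[int]_(m + n)) :
  ext_best_approx Theta v -> ext_best_approx Theta (- v).
Proof.
case=> vb vy; rewrite /ext_best_approx !raddfN; split; first exact: best_approxN.
by move=> j; rewrite linformN dist_intN mxE intrN -opprD normrN.
Qed.

(** Bounding [x] bounds each form, and [y_j] lies within 1/2 of [- L_j(x)]. This supplies the finite
    list required by [exists_enumeration]. *)
Lemma ext_best_approx_bounded Theta (B : nat) : exists F : seq 'rV[int]_(m + n),
  forall v, ext_best_approx Theta v -> (maxnorm (lsubmx v) < B)%N -> v \in F.
Proof.
pose b j := \sum_i `|Theta j i| * B%:R.
pose C := (B + \sum_j (Num.truncn (b j)).+2)%N.
exists (int_cube (m + n) C) => v [_ vy] vB; apply: mem_int_cube => i.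
case: (split_ordP i) => j ->.
  have -> : v ord0 (lshift n j) = lsubmx v ord0 j by rewrite mxE.
  by rewrite (leq_trans (leq_maxnorm _ _)) // (leq_trans (ltnW vB)) // leq_addr.
have -> : v ord0 (rshift m j) = rsubmx v ord0 j by rewrite mxE.
have Lb : `|linform Theta j (lsubmx v)| <= b j.
  apply: le_trans (ler_norm_sum _ _ _) _; apply: ler_sum => k _.
  rewrite normrM ler_wpM2l // -intr_norm -abszE -pmulrn ler_nat.
  exact: leq_trans (leq_maxnorm _ _) (ltnW vB).
have yb : `|(rsubmx v ord0 j)%:~R : R| <= b j + 1 / 2.
  have d2 : dist_int (linform Theta j (lsubmx v)) <= 1 / 2.
    by have [y ? ->] := dist_int_nearest (linform Theta j (lsubmx v)).
  rewrite -vy in d2.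
  rewrite -[X in `|X|](addKr (linform Theta j (lsubmx v))).
  by rewrite (le_trans (ler_normD _ _)) // normrN lerD.
apply: (@leq_trans (Num.truncn (b j)).+2); last first.
  by rewrite /C (bigD1 j) //=; lia.
rewrite -(ler_nat R) -natr1 (le_trans _ (lerD (ltW (truncnS_gt (b j))) (lexx 1))) //.
by rewrite pmulrn abszE intr_norm; move: yb; lra.
Qed.

End Symmetry.

(** * Dimension of spans: two independent vectors and coordinate planes *)

Section PlaneSpan.
Context {R : realType} {d : nat}.

Lemma free_pair (a b : 'rV[R]_d) (i j : 'I_d) :
  a ord0 i * b ord0 j != a ord0 j * b ord0 i -> free [:: a; b].
Proof.
move=> ab; rewrite free_cons seq1_free span_seq1; apply/andP; split.
  by apply: contra ab => /vlineP[c ->]; rewrite !mxE; apply/eqP; ring.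
by apply: contra ab => /eqP ->; rewrite !mxE !mulr0.
Qed.

Lemma dim_ge2 (U : {vspace 'rV[R]_d}) (a b : 'rV[R]_d) :
  free [:: a; b] -> a \in U -> b \in U -> (2 <= \dim U)%N.
Proof.
move=> /eqP ab aU bU; apply: leq_trans (dimvS (U := <<[:: a; b]>>%VS) _).
  by rewrite ab.
apply/span_subvP => v.
by rewrite !inE => /orP[]/eqP ->.
Qed.

(** The two unit vectors are integral, so they belong to the lattice itself; this gives minimality
    of the span. *)
Lemma span_dim_coordinate_plane (i j : 'I_d) : i != j ->
  span_dim_is R [set v : 'rV[int]_d | forall l, l != i -> l != j -> v ord0 l = 0] 2.
Proof.
move=> ij; pose e l : 'rV[R]_d := delta_mx ord0 l.
have eE l : e l = map_mx intr (delta_mx ord0 l : 'rV[int]_d).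
  by rewrite map_delta_mx.
have e_free : free [:: e i; e j].
  apply: (@free_pair _ _ i j); rewrite !mxE !eqxx [j == i]eq_sym (negbTE ij) /=.
  by rewrite mulr1 mulr0 oner_eq0.
exists <<[:: e i; e j]>>%VS; split; last exact/eqP.
  move=> v vL.
  have -> : map_mx intr v = (v ord0 i)%:~R *: e i + (v ord0 j)%:~R *: e j.
    apply/rowP => l; rewrite !mxE !eqxx /=.
    have [->|li] := eqVneq l i; first by rewrite (negbTE ij) mulr1 mulr0 addr0.
    have [->|lj] := eqVneq l j; first by rewrite mulr1 mulr0 add0r.
    by rewrite (vL l) // !mulr0 addr0.
  by rewrite memvD // memvZ // memv_span // !inE eqxx ?orbT.
move=> W WL; apply/span_subvP => v; rewrite !inE => /orP[]/eqP ->; rewrite eE;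
  apply: WL => l li lj; rewrite mxE.
- by rewrite (negbTE li) andbF.
- by rewrite (negbTE lj) andbF.
Qed.

End PlaneSpan.

(** * Forms and [zeta] on vectors supported on the first two coordinates *)

Section Family.
Context {R : realType} {m n : nat}.
Variables (xi : R) (T : 'M[R]_(n, m.+1)) (last : 'I_n).
Hypotheses (hxi : 0 < xi < 1) (xi_irr : irrational xi).
Hypotheses (Tadm : admissible T) (lastE : last.+1 = n).
Implicit Types (x : 'rV[int]_m.+2).

Let Theta := dependent_mx xi T.
Let w x : R := (x ord0 1)%:~R * xi - (x ord0 ord0)%:~R.
Let planar x := forall i : 'I_m.+2, i != ord0 -> i != 1 -> x ord0 i = 0.
Let conv k : 'rV[int]_m.+2 := lsubmx (convergent_vec m.+2 n xi k).
Let err k : R := (cf_den xi k)%:~R * xi - (cf_num xi k)%:~R.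

Lemma lift10 : lift (1 : 'I_m.+2) ord0 = ord0.
Proof. exact: val_inj. Qed.

Lemma convE k i : conv k ord0 i =
  if val i == 0%N then cf_num xi k else if val i == 1%N then cf_den xi k else 0.
Proof. by rewrite /conv /convergent_vec row_mxKl mxE. Qed.

Lemma conv0 k : conv k ord0 ord0 = cf_num xi k. Proof. by rewrite convE. Qed.

Lemma conv1 k : conv k ord0 1 = cf_den xi k. Proof. by rewrite convE. Qed.

Lemma conv_planar k : planar (conv k).
Proof.
move=> i /eqP i0 /eqP i1; rewrite convE.
case: ifP => [/eqP iv|_]; first by case: i0; exact: val_inj.
by case: ifP => [/eqP iv|//]; case: i1; exact: val_inj.
Qed.

Lemma w_conv k : w (conv k) = err k.
Proof. by rewrite /w conv0 conv1. Qed.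

Lemma maxnorm_conv k : (maxnorm (conv k))%:Z = cf_den xi k.
Proof.
have /andP[p0 pq] := cf_num_itv hxi xi_irr k.
have le_den : (maxnorm (conv k) <= `|cf_den xi k|)%N.
  by apply: maxnorm_leq => i; rewrite convE; case: ifP => _; last case: ifP => _; lia.
by have := leq_maxnorm (conv k) 1; rewrite conv1; lia.
Qed.

Lemma conv_neq0 k : conv k != 0.
Proof.
apply/eqP => k0; have := cf_den_ge1 hxi xi_irr k.
by rewrite -conv1 k0 mxE.
Qed.

Lemma planar_eq (x y : 'rV[int]_m.+2) : planar x -> planar y ->
  x ord0 ord0 = y ord0 ord0 -> x ord0 1 = y ord0 1 -> x = y.
Proof.
move=> px py xy0 xy1; apply/matrixP => i l; rewrite !ord1.
have [->//|l0] := eqVneq l ord0; have [->//|l1] := eqVneq l 1.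
by rewrite px ?py.
Qed.

(** The coefficients other than the first are integers, and the first is [- w x]. *)
Lemma not_far x : ~ far xi x -> planar x /\ `|w x| < 1 / 2.
Proof.
move=> xfar.
have small i : `|coef xi x i| < 1 / 2.
  by rewrite ltNge; apply/negP => xi2; apply: xfar; exists i.
split=> [i i0 i1|]; last first.
  have := small ord0; rewrite /coef eqxx lift10 distrC /w.
  by rewrite [xi * _]mulrC.
case: (unliftP 1 i) => [j ij|ij]; last by rewrite ij eqxx in i1.
have j0 : j != ord0 by apply: contraNneq i0 => j0; rewrite ij j0 lift10.
have := small j; rewrite /coef (negbTE j0) subr0 -ij -intr_norm => xi2.
have : `|x ord0 i|%:~R < 1 :> R by lra.
by rewrite (ltr_int _ _ 1); lia.
Qed.

Lemma linform_planar j x : planar x -> linform Theta j x = - (T j ord0 * w x).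
Proof.
move=> px; rewrite linform_dependent (bigD1 ord0) //= big1 => [|i i0].
  by rewrite /coef eqxx lift10 /w; ring.
rewrite /coef (negbTE i0) subr0 px ?mulr0 //.
  by rewrite -lift10 (inj_eq lift_inj).
by rewrite eq_sym neq_lift.
Qed.

(** The value 2/3 separates the last entry of the column from the others, so the last row governs
    [zeta] on planar vectors. *)
Lemma col0_le_last j : 0 < T j ord0 <= T last ord0.
Proof.
have := admissible_itv j ord0 Tadm => /andP[-> _] /=.
have [-> //|jl] := eqVneq j last.
have [T0 _] := Tadm; have := T0 last; rewrite lastE eqxx.
have := T0 j; rewrite ifF; first by lra.
by apply: contraNF jl => /eqP jn; apply/eqP/val_inj => /=; lia.
Qed.

Lemma zeta_planar_le x : planar x -> zeta Theta x <= T last ord0 * `|w x|.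
Proof.
have /andP[l0 _] := col0_le_last last.
move=> px; apply: zeta_le => [|j]; first by rewrite mulr_ge0 // ltW.
apply: le_trans (dist_int_le_norm _) _; rewrite linform_planar // normrN normrM.
by have /andP[j0 jl] := col0_le_last j; rewrite (gtr0_norm j0) ler_wpM2r.
Qed.

Lemma zeta_planar_ge x : planar x -> `|w x| < 1 / 2 ->
  T last ord0 * `|w x| <= zeta Theta x.
Proof.
move=> px wx; apply: le_trans (dist_int_le_zeta _ last _).
have /andP[l0 l1] := admissible_itv last ord0 Tadm.
rewrite linform_planar // dist_intN dist_int_id normrM gtr0_norm //.
by have := normr_ge0 (w x); nra.
Qed.

Lemma zeta_conv_lt k : zeta Theta (conv k) < (cf_den xi k.+1)%:~R^-1.
Proof.
apply: le_lt_trans (zeta_planar_le (conv_planar k)) _; rewrite w_conv.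
apply: le_lt_trans (cf_err_lt hxi xi_irr k).
by rewrite ler_piMl //; have /andP[_ /ltW] := admissible_itv last ord0 Tadm.
Qed.

(** * Best approximations and rank for generic parameters *)

Section Generic.
Variable Q0 : nat.
Hypothesis far_large : forall Q x, (Q0 <= Q)%N -> far xi x ->
  (maxnorm x <= Q)%N -> Q%:R^-1 < zeta Theta x.

(** Compare with the convergent such that [q_k <= M(x) < q_(k+1)]. If [x] were far, then
    [1 / M(x) < zeta(x) < 1 / q_(k+1)], which is absurd. So [x] is planar with error at most that of
    convergent [k], and the equality case of [cf_best_approx] applies. *)
Lemma best_approx_is_conv x : best_approx Theta x -> (Q0 <= maxnorm x)%N ->
  exists k, x = conv k \/ x = - conv k.
Proof.
move=> [x0 xbest] Q0x.
have M0 : (0 < maxnorm x)%N.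
  rewrite lt0n; apply: contra x0 => /eqP Mx; apply/eqP/rowP => i.
  by rewrite mxE -[x 0 i]/(x ord0 i); have := leq_maxnorm x i; lia.
have [k /andP[k1 k2]] := cf_den_bracket hxi xi_irr M0.
have zk : zeta Theta x <= zeta Theta (conv k).
  by apply: xbest; [exact: conv_neq0|have := maxnorm_conv k; lia].
have [px wx] : planar x /\ `|w x| < 1 / 2.
  apply: not_far => xfar.
  have := lt_trans (lt_le_trans (far_large Q0x xfar (leqnn _)) zk) (zeta_conv_lt k).
  apply/negP; rewrite -leNgt lef_pV2 ?posrE ?ltr0n //; last first.
    by rewrite (ltr_int _ 0); have := cf_den_ge1 hxi xi_irr k.+1; lia.
  by rewrite pmulrn ler_int; lia.
have [||_] := @cf_best_approx _ _ hxi xi_irr k (x ord0 ord0) (x ord0 1).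
- by have := leq_maxnorm x 1; lia.
- apply: contraNT x0; rewrite negb_or !negbK => /andP[/eqP x00 /eqP x01].
  by apply/eqP/planar_eq => //; rewrite ?mxE // => i _ _; rewrite mxE.
case=> [|s s1 [xs0 xs1]].
  have /andP[l0 _] := col0_le_last last.
  rewrite -(ler_pM2l l0) (le_trans (zeta_planar_ge px wx)) // (le_trans zk) //.
  by have := zeta_planar_le (conv_planar k); rewrite w_conv.
exists k; case: s1 xs0 xs1 => -> xs0 xs1; [left|right]; apply: planar_eq => //.
- exact: conv_planar.
- by rewrite conv0 xs0 mul1r.
- by rewrite conv1 xs1 mul1r.
- by move=> i i0 i1; rewrite mxE conv_planar ?oppr0.
- by rewrite mxE conv0 xs0 mulN1r.
- by rewrite mxE conv1 xs1 mulN1r.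
Qed.

(** Far competitors lose by genericity, planar ones by [cf_best_approx]. The index is positive so
    that [|x_1| <= q_(k+1) < q_(k+2)]. *)
Lemma conv_best_approx k : (Q0 <= maxnorm (conv k.+1))%N ->
  best_approx Theta (conv k.+1).
Proof.
move=> Q0k; split=> [|x x0 xk]; first exact: conv_neq0.
have Mk := maxnorm_conv k.+1.
have d1 := cf_den_ge1 hxi xi_irr k.+1.
have d2 := ltr_cf_den hxi xi_irr k.
have [xfar|/not_far[px wx]] := pselect (far xi x).
  apply: ltW; apply: le_lt_trans (far_large Q0k xfar xk).
  apply: le_trans (ltW (zeta_conv_lt _)) _; rewrite pmulrn Mk.
  by rewrite lef_pV2 ?posrE ?(ltr_int _ 0) ?ler_int; lia.
apply: le_trans (zeta_planar_le (conv_planar _)) (le_trans _ (zeta_planar_ge px wx)).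
have /andP[l0 _] := col0_le_last last.
rewrite ler_pM2l // w_conv; apply: (cf_best_approx hxi xi_irr _ _).1.
  by have := leq_maxnorm x 1; lia.
apply: contraNT x0; rewrite negb_or !negbK => /andP[/eqP x00 /eqP x01].
by apply/eqP/planar_eq => //; rewrite ?mxE // => i _ _; rewrite mxE.
Qed.

Lemma err_lt_half k : `|err k.+1| < 1 / 2.
Proof.
have d1 := cf_den_ge1 hxi xi_irr k.+1; have d2 := ltr_cf_den hxi xi_irr k.
apply: lt_le_trans (cf_err_lt hxi xi_irr k.+1) _.
have d3 : 2 <= (cf_den xi k.+2)%:~R :> R by rewrite (ler_int _ 2); lia.
by rewrite div1r lef_pV2 ?posrE //; lra.
Qed.

Lemma linform_conv_lt_half j k : `|linform Theta j (conv k.+1)| < 1 / 2.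
Proof.
rewrite linform_planar ?normrN ?normrM ?w_conv; last exact: conv_planar.
have /andP[l0 l1] := admissible_itv j ord0 Tadm.
by rewrite gtr0_norm //; have := err_lt_half k; have := normr_ge0 (err k.+1); nra.
Qed.

Lemma ext_conv k : (Q0 <= maxnorm (conv k.+1))%N ->
  ext_best_approx Theta (convergent_vec m.+2 n xi k.+1).
Proof.
move=> Q0k; split=> [|j]; first exact: conv_best_approx.
rewrite row_mxKr mxE addr0 dist_int_id //.
exact/ltW/linform_conv_lt_half.
Qed.

(** All forms are below 1/2 in absolute value, so 0 is the only nearest integer and the right block
    vanishes. *)
Lemma ext_of_conv v k : ext_best_approx Theta v -> lsubmx v = conv k.+1 ->
  v = convergent_vec m.+2 n xi k.+1.
Proof.
move=> [_ vy] vk; rewrite -[v]hsubmxK -[RHS]hsubmxK vk; congr row_mx.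
apply/rowP => j; rewrite row_mxKr [RHS]mxE.
have Lj := linform_conv_lt_half j k.
have := vy j; rewrite vk dist_int_id; last exact: ltW.
move=> yE; have : `|(rsubmx v ord0 j)%:~R : R| < 1.
  rewrite -[X in `|X|](addKr (linform Theta j (conv k.+1))).
  by rewrite (le_lt_trans (ler_normD _ _)) // normrN yE; lra.
by rewrite -intr_norm (ltr_int _ _ 1) -[_ 0 j]/(rsubmx v ord0 j); lia.
Qed.

(** Since [q_k >= k], the bound [Q0] ensures genericity from [K] on; the bound 2 ensures
    [q_(K-1) < q_K]. *)
Let K := (maxn 2 Q0).
Let M (v : 'rV[int]_(m.+2 + n)) := maxnorm (lsubmx v).
Let E : set 'rV[int]_(m.+2 + n) := ext_best_approx Theta.
Let cv := convergent_vec m.+2 n xi.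

Lemma cf_den_homo : {homo cf_den xi : i j / (i <= j)%N >-> i <= j}.
Proof.
by apply: homo_leq => [||k]; [exact: lexx|exact: le_trans|exact: ler_cf_den].
Qed.

Lemma M_opp_ext v : M (- v) = M v.
Proof. by rewrite /M raddfN maxnormN. Qed.

Lemma cv_E k : (K <= k)%N -> E (cv k).
Proof.
case: k => [|k]; first by rewrite /K; lia.
move=> Kk; apply: ext_conv.
by have := maxnorm_conv k.+1; have := cf_den_unbounded hxi xi_irr k.+1; rewrite /K in Kk; lia.
Qed.

Lemma cv_lt k : (K <= k)%N -> (M (cv k) < M (cv k.+1))%N.
Proof.
case: k => [|k]; first by rewrite /K; lia.
move=> _; have := ltr_cf_den hxi xi_irr k.
by rewrite -!maxnorm_conv.
Qed.

Lemma E_cv v : E v -> (M (cv K) <= M v)%N ->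
  exists2 k, (K <= k)%N & v = cv k \/ v = - cv k.
Proof.
move=> Ev Mv.
have MK : (M (cv K))%:Z = cf_den xi K := maxnorm_conv K.
have [|k vk] := best_approx_is_conv Ev.1.
  apply: leq_trans Mv; have := cf_den_unbounded hxi xi_irr K; rewrite /K in MK *; lia.
have Mk : (M v)%:Z = cf_den xi k.
  by rewrite -maxnorm_conv /M; case: vk => ->; rewrite ?maxnormN.
(* An index below [K] would give a norm at most [q_(K-1) < q_K]. *)
have Kk : (K <= k)%N.
  rewrite leqNgt; apply/negP => kK.
  have [K' KE] : exists K', K = K'.+2 by exists (K - 2)%N; rewrite /K; lia.
  have kK' : (k <= K'.+1)%N by lia.
  have := cf_den_homo kK'; have := ltr_cf_den hxi xi_irr K'; rewrite -KE; lia.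
exists k => //; case: k Kk vk {Mk} => [|k] Kk vk; first by rewrite /K in Kk; lia.
case: vk => vk; [left|right]; first exact: ext_of_conv.
apply: oppr_inj; rewrite opprK; apply: ext_of_conv; first exact: ext_best_approxN.
by rewrite raddfN /= vk opprK.
Qed.

Lemma best_approx_seq_tail z : best_approx_seq Theta z ->
  exists N, forall nu, z (N + nu)%N = cv (K + nu)%N \/ z (N + nu)%N = - cv (K + nu)%N.
Proof. exact: (enumeration_tail M_opp_ext cv_E cv_lt E_cv). Qed.

Lemma exists_best_approx_seq : exists z, best_approx_seq Theta z.
Proof.
have [F EF] := ext_best_approx_bounded Theta (M (cv K)).
exact: (exists_enumeration M_opp_ext cv_E cv_lt E_cv (@ext_best_approxN _ _ _ _) EF).
Qed.

(** The plane of the first two coordinates contains the tail. Conversely any admissible lattice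
    contains, after undoing signs, two consecutive convergent vectors, and these are independent
    because their determinant is a power of -1. *)
Lemma rank_eq2 : rank_is Theta 2.
Proof.
pose i0 : 'I_(m.+2 + n) := lshift n ord0; pose i1 : 'I_(m.+2 + n) := lshift n 1.
have cv0 k : cv k ord0 i0 = cf_num xi k by rewrite -conv0 [RHS]mxE.
have cv1 k : cv k ord0 i1 = cf_den xi k by rewrite -conv1 [RHS]mxE.
split.
  have [z zE] := exists_best_approx_seq; exists z => //.
  exists [set v | forall l, l != i0 -> l != i1 -> v ord0 l = 0]; split.
  - split=> [l _ _|u v uL vL l l0 l1]; first by rewrite mxE.
    by rewrite !mxE uL // vL // subrr.
  - exact: span_dim_coordinate_plane.
  - have [N zN] := best_approx_seq_tail zE; exists N => nu Nnu l l0 l1.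
    have cvl k : cv k ord0 l = 0.
      case: (split_ordP l) => j lj; rewrite lj; last by rewrite row_mxEr mxE.
      rewrite row_mxEl -[RHS](@conv_planar k j) ?convE ?mxE //.
      + by apply: contraNneq l0 => j0; rewrite lj j0.
      + by apply: contraNneq l1 => j1; rewrite lj j1.
    have := zN (nu - N)%N; rewrite subnKC // => -[->|->]; first exact: cvl.
    by rewrite mxE cvl oppr0.
move=> r [z zE [L [[L0 LB] [U [LU _ <-]] [N0 zL]]]].
have [N zN] := best_approx_seq_tail zE.
have LN v : L (- v) -> L v by move=> Lv; rewrite -[v]opprK -sub0r; exact: LB.
have Lcv nu : (N0 <= nu)%N -> L (cv (K + nu)%N).
  move=> N0nu; have := zL (N + nu)%N (leq_trans N0nu (leq_addl _ _)).
  by case: (zN nu) => -> //; exact: LN.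
apply: (dim_ge2 _ (LU _ (Lcv N0 (leqnn _))) (LU _ (Lcv N0.+1 (leqnSn _)))).
have mapE (u : 'rV[int]_(m.+2 + n)) l : map_mx intr u ord0 l = (u ord0 l)%:~R :> R.
  by rewrite mxE.
apply: (@free_pair _ _ _ _ i0 i1); rewrite !mapE !cv0 !cv1 addnS -!intrM.
rewrite eqr_int -subr_eq0 -oppr_eq0 opprB [cf_den _ _ * _]mulrC cf_det //.
by rewrite expf_neq0.
Qed.

End Generic.
End Family.

Unset Implicit Arguments.

(* The number of columns is m.+2, i.e. an arbitrary integer >= 2. *)
Theorem theorem10 (R : realType) (m n : nat) (hn : (m.+2 < n)%N)
    (xi : R) (hxi : 0 < xi < 1) (xi_irr : irrational xi) :
  almost_all_in (@admissible R m n)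
    [set T | (forall z, best_approx_seq (dependent_mx xi T) z ->
                differ_finitely z (convergent_vec m.+2 n xi)) /\
             rank_is (dependent_mx xi T) 2%N].
Proof.
apply: almost_all_in_sub (almost_all_generic xi hn) => T Tadm [Q0 Tgen].
(* The distinguished row, where column 0 exceeds 2/3, has index [n.-1]. *)
have n0 : (n.-1 < n)%N by rewrite ltn_predL; apply: leq_trans hn.
have lastE : (Ordinal n0).+1 = n by rewrite /= prednK //; apply: leq_trans hn.
split=> [z zE|]; last exact: (rank_eq2 hxi xi_irr Tadm lastE Tgen).
have [N zN] := best_approx_seq_tail hxi xi_irr Tadm lastE Tgen zE.
by exists N, (maxn 2 Q0).
Qed.
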